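(* $N(2)=6$; that is, $6$ is the smallest $N$ such that $\mathbf{R}^2$ admits a totally skew embedding in $\mathbf{R}^N$.
   Context: A pair of lines in $\mathbf{R}^N$ is skew if they are not parallel and do not intersect (in particular, two equal lines are not skew). A submanifold $M^n\subset\mathbf{R}^N$ (with $C^1$ regularity) is totally skew if every pair of (affine) tangent lines of $M$ is skew, unless they are tangent to $M$ at the same point. A ($C^1$) embedding is totally skew if its image is a totally skew submanifold. $N(n)$ denotes the smallest $N$ such that $\mathbf{R}^n$ admits a totally skew embedding in $\mathbf{R}^N$. *)

(* Defs.v *)
From mathcomp Require Import all_boot all_order all_algebra.
From mathcomp Require Import all_classical all_reals all_analysis.

Set Implicit Arguments.
Unset Strict Implicit.
Unset Printing Implicit Defensive.

Import Order.TTheory GRing.Theory Num.Theory.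
Import numFieldNormedType.Exports.

Local Open Scope classical_set_scope.
Local Open Scope ring_scope.

Section TotallySkew.
Variable R : realType.

Definition C1 n N (f : 'rV[R]_n -> 'rV[R]_N) : Prop :=
  (forall x, differentiable f x) /\ continuous (jacobian f).

Definition C1_curve N (c : R -> 'rV[R]_N) : Prop :=
  (forall t, derivable c t 1) /\ continuous (derive1 c).

(* Injective C^1 immersion that is a homeomorphism onto its image: the last
   clause says that f is open onto [range f] with the subspace topology. *)
Definition C1_embedding n N (f : 'rV[R]_n -> 'rV[R]_N) : Prop :=
  [/\ C1 f,
      forall x, injective ('d f x),
      injective f &
      forall A : set 'rV[R]_n, open A ->
        exists2 B : set 'rV[R]_N, open B & f @` A = B `&` range f].

(* Local parametrizations are taken over the whole of R^n, which is no
   restriction since R^n is diffeomorphic to an open ball. *)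
Definition C1_submanifold n N (M : set 'rV[R]_N) : Prop :=
  forall p, M p ->
    exists U : set 'rV[R]_N, [/\ open U, U p &
      exists2 g : 'rV[R]_n -> 'rV[R]_N, C1_embedding g & range g = M `&` U].

Definition tangent_vector N (M : set 'rV[R]_N) (p v : 'rV[R]_N) : Prop :=
  exists c : R -> 'rV[R]_N,
    [/\ C1_curve c, \forall t \near (0 : R), M (c t), c 0 = p &
        derive1 c 0 = v].

Definition line N (p v : 'rV[R]_N) : set 'rV[R]_N :=
  [set p + t *: v | t in [set: R]].

Definition tangent_line N (M : set 'rV[R]_N) (p : 'rV[R]_N)
    (L : set 'rV[R]_N) : Prop :=
  exists v, [/\ tangent_vector M p v, v != 0 & L = line p v].

(* Meant for lines, which are parallel when they are translates of each
   other; in particular every line is parallel to itself. *)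
Definition parallel N (L1 L2 : set 'rV[R]_N) : Prop :=
  exists w, L2 = [set q + w | q in L1].

Definition skew_lines N (L1 L2 : set 'rV[R]_N) : Prop :=
  ~ parallel L1 L2 /\ L1 `&` L2 = set0.

Definition totally_skew_submanifold n N (M : set 'rV[R]_N) : Prop :=
  C1_submanifold n M /\
  forall p q L1 L2, M p -> M q -> p <> q ->
    tangent_line M p L1 -> tangent_line M q L2 -> skew_lines L1 L2.

Definition totally_skew_embedding n N (f : 'rV[R]_n -> 'rV[R]_N) : Prop :=
  C1_embedding f /\ totally_skew_submanifold n (range f).

Definition admits_totally_skew_embedding n N : Prop :=
  exists f : 'rV[R]_n -> 'rV[R]_N, totally_skew_embedding f.

Definition is_least_skew_dim n N : Prop :=
  admits_totally_skew_embedding n N /\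
  forall N', admits_totally_skew_embedding n N' -> (N <= N')%N.

End TotallySkew.

(* Main.v *)
Require Import Defs.
From mathcomp Require Import all_boot all_order all_algebra.
From mathcomp Require Import all_classical all_reals all_analysis.
From mathcomp Require Import ring lra.

Set Implicit Arguments.
Unset Strict Implicit.
Unset Printing Implicit Defensive.

Import Order.TTheory GRing.Theory Num.Theory.
Import numFieldNormedType.Exports.

Local Open Scope classical_set_scope.
Local Open Scope ring_scope.

(* Identify R^6 with C^3. The moment curve z |-> (z, z^2, z^3) is totally skew
   because f(z) - f(w), f'(z), f'(w) are linearly independent over C when
   z <> w. Conversely, total skewness of f : R^n -> R^N says that for p <> q
   the 2n+1 vectors f(p) - f(q), d_i f(p), d_i f(q) are linearly independent,
   so N > 2n. If n = 2 and N = 5, their determinant D(p, q) never vanishes for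
   p <> q, while D(q, p) = - D(p, q) because exchanging two blocks of two rows
   is an even permutation; as the configuration space of pairs of distinct
   points of R^2 is connected, this contradicts the intermediate value
   theorem. *)

(** * Continuity and differentiability of matrix-valued maps, entry by entry *)

Lemma continuous_mx (T U : topologicalType) m n (f : T -> 'M[U]_(m, n)) :
  (forall i j, continuous (fun x => f x i j)) -> continuous f.
Proof.
move=> cf x A [P fP PA].
suff fxP : \forall y \near x, forall ij, P ij.1 ij.2 (f y ij.1 ij.2).
  by apply: filterS fxP => y Py; apply: PA => i j; exact: (Py (i, j)).
(* There are finitely many entries, so their neighbourhoods of [x] can be intersected. *)
apply: filter_forall => -[i j] /=; exact: (cf i j x _ (fP i j)).
Qed.

Lemma continuous_entry (R : realType) (T : topologicalType) m n
    (f : T -> 'M[R]_(m, n)) i j :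
  continuous f -> continuous (fun x => f x i j).
Proof.
move=> cf x; apply: (continuous_comp (g := fun A : 'M[R]_(m, n) => A i j)).
  exact: cf.
exact: coord_continuous.
Qed.

Lemma continuous_mulmx (R : realType) (T : topologicalType) m n p
    (f : T -> 'M[R]_(m, n)) (g : T -> 'M[R]_(n, p)) :
  continuous f -> continuous g -> continuous (fun x => f x *m g x).
Proof.
move=> cf cg; apply: continuous_mx => i j.
under [X in continuous X]funext do rewrite mxE.
apply: continuous_big => [|k _ x]; first exact: add_continuous.
by apply: cvgM; exact: continuous_entry.
Qed.

Lemma continuous_det (R : realType) (T : topologicalType) n
    (f : T -> 'M[R]_n) : continuous f -> continuous (fun x => \det (f x)).
Proof.
move=> cf; apply: continuous_big => [|s _ x]; first exact: add_continuous.
apply: cvgM; first exact: cvg_cst.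
apply: cvg_big => [|i _]; first exact: mul_continuous.
exact: continuous_entry.
Qed.

Lemma continuous_col_mx (R : realType) (T : topologicalType) m1 m2 n
    (f : T -> 'M[R]_(m1, n)) (g : T -> 'M[R]_(m2, n)) :
  continuous f -> continuous g -> continuous (fun x => col_mx (f x) (g x)).
Proof.
move=> cf cg; apply: continuous_mx => i j.
under [X in continuous X]funext do rewrite mxE.
by case: (fintype.split i) => k; exact: continuous_entry.
Qed.

Lemma differentiable_row (R : realType) (V : normedModType R) n
    (f : V -> 'rV[R]_n) x :
  (forall j, differentiable (fun y => f y 0 j : R) x) -> differentiable f x.
Proof.
move=> df.
have -> : f = \sum_(j < n) (fun y => f y 0 j *: delta_mx 0 j).
  by apply/funext => y; rewrite fct_sumE -row_sum_delta.
by apply: differentiable_sum => j; exact: differentiableZl.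
Qed.

(** * Linear independence from total skewness, and the bound N > 2n *)

Section LowerBound.
Context {R : realType} {n N : nat}.
Implicit Type f : 'rV[R]_n -> 'rV[R]_N.

Lemma diff_jacobian f p u : 'd f p u = u *m jacobian f p.
Proof. by rewrite /jacobian mul_rV_lin1. Qed.

(** The witness is the image under [f] of the straight line through [p] with velocity [u]. *)
Lemma tangent_vector_diff f p u :
  C1 f -> tangent_vector (range f) (f p) ('d f p u).
Proof.
move=> [df cJ].
pose l (t : R) := p + t *: u.
have dl t : is_diff t l ( *:%R^~ u).
  by apply: is_diff_eq; rewrite add0r.
have dc t : differentiable (f \o l) t by apply: differentiable_comp.
have c' t : derive1 (f \o l) t = 'd f (l t) u.
  by rewrite derive1E deriveE// diff_comp//= (diff_val (f := l))/= scale1r.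
exists (f \o l); split.
- split=> [t|]; first exact: diff_derivable.
  rewrite (funext c'); under [X in continuous X]funext do rewrite diff_jacobian.
  apply: continuous_mulmx => t; first exact: cvg_cst.
  apply: cvg_comp; last exact: cJ.
  exact/differentiable_continuous.
- by near=> t; exists (l t).
- by rewrite /= /l scale0r addr0.
- by rewrite c' /l scale0r addr0.
Unshelve. all: by end_near. Qed.

Lemma line_base (p v : 'rV[R]_N) : line p v p.
Proof. by exists 0 => //; rewrite scale0r addr0. Qed.

(** The opposite sign is the form produced by a relation [u *m J p + v *m J q = 0]. *)
Lemma line_parallel (p q v : 'rV[R]_N) :
  parallel (line p v) (line q (- v)).
Proof.
exists (q - p); apply/seteqP; split => x.
- move=> [t _ <-]; exists (p - t *: v).
    by exists (- t) => //; rewrite scaleNr.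
  by rewrite scalerN addrC addrA subrK addrC.
- move=> [_ [t _ <-] <-]; exists (- t) => //.
  by rewrite scalerN scaleNr opprK [RHS]addrC addrA subrK.
Qed.

Lemma parallel_line (p q v w : 'rV[R]_N) :
  parallel (line p v) (line q w) -> exists k, w = k *: v.
Proof.
move=> [s E].
have [_ [t _ <-] Et] : [set x + s | x in line p v] q.
  by rewrite -E; exact: line_base.
have [_ [t' _ <-] Et'] : [set x + s | x in line p v] (q + w).
  by rewrite -E; exists 1 => //; rewrite scale1r.
exists (t' - t); apply: (addrI q).
rewrite -{}Et' -{}Et scalerBl [RHS]addrAC -[p + _ + (_ - _)]addrA.
by rewrite [t *: v + _]addrC subrK.
Qed.

(** A left kernel vector splits as (a, u, v). If a is nonzero, dividing by it gives a common point
    of the two tangent spaces, hence intersecting tangent lines; if a = 0, nonzero u and v would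
    give parallel tangent lines. *)
Lemma totally_skew_row_free f p q : (0 < n)%N ->
  totally_skew_embedding f -> p != q ->
  row_free (col_mx (f p - f q) (col_mx (jacobian f p) (jacobian f q))).
Proof.
move=> n0 [[C1f df_inj f_inj _] [_ skew]] /eqP pq.
have [e e0] : exists e : 'rV[R]_n, e != 0.
  exists (const_mx 1); apply/rV0Pn; exists (Ordinal n0).
  by rewrite mxE oner_eq0.
pose J := jacobian f.
have J0 x (u : 'rV_n) : u *m J x = 0 -> u = 0.
  by move=> Ju0; apply: (df_inj x); rewrite !diff_jacobian mul0mx.
have tangent x (u : 'rV_n) : u != 0 ->
    tangent_line (range f) (f x) (line (f x) (u *m J x)).
  move=> u0; exists (u *m J x); split => //.
    by rewrite -diff_jacobian; exact: tangent_vector_diff.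
  by apply: contra_neq u0; exact: J0.
have skewJ u v : u != 0 -> v != 0 ->
    skew_lines (line (f p) (u *m J p)) (line (f q) (v *m J q)).
  move=> u0 v0; apply: skew (tangent p u u0) (tangent q v v0).
  - by exists p.
  - by exists q.
  - by move/f_inj.
(* For [u = 0] the point is [f x] itself, which lies on the tangent line in the auxiliary nonzero
   direction [e]; such an [e] exists because [0 < n]. *)
have on_line x u :
    exists2 u', u' != 0 & line (f x) (u' *m J x) (f x + u *m J x).
  have [->|u0] := eqVneq u 0.
    by exists e => //; rewrite mul0mx addr0; exact: line_base.
  by exists u => //; exists 1 => //; rewrite scale1r.
have disj u v : f p + u *m J p != f q + v *m J q.
  apply/eqP => E; have [u' u'0 pu'] := on_line p u.
  have [v' v'0 qv'] := on_line q v.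
  have [_] := skewJ _ _ u'0 v'0; rewrite -subset0; apply.
  by split; first exact: pu'; rewrite E.
(* If one of [u], [v] is zero, injectivity of the differential makes the other zero too. *)
have transv (u v : 'rV_n) : u *m J p + v *m J q = 0 -> u = 0 /\ v = 0.
  move=> E; have [u0|u0] := eqVneq u 0.
    by split=> //; apply: (J0 q); rewrite -E u0 mul0mx add0r.
  have [v0|v0] := eqVneq v 0.
    by split=> //; apply: (J0 p); rewrite -E v0 mul0mx addr0.
  have [np _] := skewJ _ _ u0 v0; exfalso; apply: np.
  by move/eqP: E; rewrite addrC addr_eq0 => /eqP ->; exact: line_parallel.
rewrite -kermx_eq0; apply/eqP/row_matrixP => i; rewrite row0.
set y := row i _.
have : y *m col_mx (f p - f q) (col_mx (jacobian f p) (jacobian f q)) = 0.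
  by rewrite /y -row_mul mulmx_ker row0.
rewrite -[y]hsubmxK -[rsubmx y]hsubmxK !mul_row_col [lsubmx y]mx11_scalar.
rewrite mul_scalar_mx -/J.
set a := lsubmx y 0 0; set u := lsubmx _; set v := rsubmx _ => E.
have [a0|a0] := eqVneq a 0.
  move: E; rewrite a0 scale0r add0r => /transv[-> ->].
  by rewrite -scalemx1 scale0r !row_mx0.
(* These are the coefficients obtained by solving [E] for [f p - f q]. *)
have /eqP[] := disj (a^-1 *: u) (- (a^-1 *: v)).
apply/eqP; rewrite mulNmx -!scalemxAl -subr_eq0 opprD opprK addrACA -scalerDr.
by rewrite -(scalerK a0 (f p - f q)) -scalerDr E scaler0.
Qed.

(** At any two distinct points, here [const_mx 1] and 0, the 1 + 2n independent rows live in a space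
    of dimension [N]. *)
Lemma totally_skew_dim_gt f : (0 < n)%N ->
  totally_skew_embedding f -> (n + n < N)%N.
Proof.
move=> n0 skf; have pq : (const_mx 1 : 'rV[R]_n) != 0.
  by apply/rV0Pn; exists (Ordinal n0); rewrite mxE oner_eq0.
have /eqP free := totally_skew_row_free n0 skf pq.
by rewrite -[(n + n).+1]/(1 + (n + n))%N -free rank_leq_col.
Qed.

End LowerBound.

(** * Exclusion of N = 5 by an antisymmetric determinant *)

Lemma det_block_swap (R : comNzRingType) m :
  \det (block_mx 0 1%:M 1%:M 0 : 'M[R]_(m + m)) = (-1) ^+ m.
Proof.
(* The swap is a product of block triangular matrices; only the middle one, with diagonal blocks -1
   and 1, has a determinant other than 1. *)
have -> : block_mx 0 1%:M 1%:M 0 =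
    block_mx 1%:M 1%:M 0 1%:M *m block_mx (- 1)%:M 0 1%:M 1%:M *m
    block_mx 1%:M (- 1)%:M 0 1%:M :> 'M[R]_(m + m).
  rewrite !mulmx_block !(mulmx0, mul0mx, mulmx1, mul1mx, add0r, addr0).
  by rewrite raddfN addNr mul0mx add0r.
by rewrite !det_mulmx !det_ublock det_lblock !det1 det_scalar !mulr1 mul1r.
Qed.

Lemma det_col_mx_swap (R : comNzRingType) m (d : 'rV[R]_(1 + (m + m)))
    (A B : 'M[R]_(m, 1 + (m + m))) :
  \det (col_mx (- d) (col_mx B A)) =
  (-1) ^+ m.+1 * \det (col_mx d (col_mx A B)).
Proof.
have -> : col_mx (- d) (col_mx B A) =
    block_mx (- 1)%:M 0 0 (block_mx 0 1%:M 1%:M 0) *m col_mx d (col_mx A B).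
  rewrite !mul_block_col !(mul0mx, mul1mx, add0r, addr0).
  by rewrite raddfN mulNmx mul1mx.
by rewrite det_mulmx det_ublock det_scalar det_block_swap -exprD.
Qed.

Lemma no_totally_skew_5 (R : realType) : ~ admits_totally_skew_embedding R 2 5.
Proof.
move=> [f skf]; have [[[df cJ] _ _ _] _] := skf.
(* An arc from -e to e avoiding 0; the pair (p t, - p t) is exchanged. *)
pose p (t : R) : 'rV[R]_2 := \row_(j < 2) (if j == 0 then t else 1 - t ^+ 2).
have p0 t : p t != - p t.
  apply/eqP => /rowP E; have := E 0; have := E 1; rewrite !mxE/= => E1 E0.
  have t0 : t = 0 by lra.
  by rewrite t0 expr0n/= in E1; lra.
have cp : continuous p.
  apply: continuous_mx => i j; under [X in continuous X]funext do rewrite mxE.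
  case: (j == 0) => t; first exact: cvg_id.
  by apply: cvgB; [exact: cvg_cst|exact: exprn_continuous].
have cf : continuous f by move=> x; exact/differentiable_continuous.
have cpN : continuous (fun t => - p t) by move=> t; apply: cvgN; exact: cp.
have comp (V : topologicalType) (c : R -> 'rV[R]_2) (g : 'rV[R]_2 -> V) :
    continuous c -> continuous g -> continuous (fun t => g (c t)).
  by move=> cc cg t; apply: continuous_comp; [exact: cc|exact: cg].
(* The matrix is square because 1 + (2 + 2) computes to 5. *)
pose D (x y : 'rV[R]_2) : R :=
  \det (col_mx (f x - f y) (col_mx (jacobian f x) (jacobian f y)) : 'M[R]_5).
have D0 x y : x != y -> D x y != 0.
  move=> xy; rewrite -unitfE -unitmxE -row_free_unit.
  exact: (@totally_skew_row_free R 2 5 f x y).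
have Dopp x y : D y x = - D x y.
  have := @det_col_mx_swap R 2 (f x - f y) (jacobian f x) (jacobian f y).
  by rewrite opprB exprS sqrrN expr1n mulr1 mulN1r.
pose h (t : R) := D (p t) (- p t).
have ch : continuous h.
  apply: continuous_det; apply: (@continuous_col_mx R R 1 4 5).
    by move=> t; apply: cvgB; exact: comp.
  by apply: (@continuous_col_mx R R 2 2 5); exact: comp.
(* The second coordinate vanishes at both ends of the arc, so the ends are opposite and [h] takes
   opposite values there. *)
have pN : p (- 1) = - p 1.
  by apply/rowP => j; rewrite !mxE; case: (j == 0) => //; ring.
have hN : h (- 1) = - h 1 by rewrite /h pN opprK Dopp.
have h0 : Num.min (h (- 1)) (h 1) <= 0 <= Num.max (h (- 1)) (h 1).
  rewrite hN ge_min le_max oppr_le0 oppr_ge0.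
  by case: (lerP 0 (h 1)) => [_|/ltW ->]; rewrite ?orbT.
have N11 : (- 1 : R) <= 1 by rewrite -subr_ge0 opprK addr_ge0.
have [t _ ht] := IVT N11 (continuous_subspaceT ch) h0.
by move/eqP: ht; apply/negP/D0.
Qed.

(** * Total skewness of the complex moment curve in R^6 *)

Section ComplexMomentCurve.
Variable R : realType.
Implicit Types z w u v : 'rV[R]_2.

Let X z : R := z 0 0.
Let Y z : R := z 0 1.

(* z |-> (z, z^2, z^3) under the identification of C with R^2. *)
Definition moment_surface z : 'rV[R]_6 := \row_(j < 6) nth 0
  [:: X z; Y z; X z ^+ 2 - Y z ^+ 2; 2 * (X z * Y z);
      X z ^+ 3 - 3 * (X z * Y z ^+ 2); 3 * (X z ^+ 2 * Y z) - Y z ^+ 3] j.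

(* The derivative at z: u |-> (u, 2zu, 3z^2u). *)
Definition dmoment_surface z u : 'rV[R]_6 := \row_(j < 6) nth 0
  [:: X u; Y u;
      2 * (X z * X u - Y z * Y u); 2 * (X z * Y u + Y z * X u);
      3 * ((X z * X z - Y z * Y z) * X u - 2 * (X z * Y z) * Y u);
      3 * ((X z * X z - Y z * Y z) * Y u + 2 * (X z * Y z) * X u)] j.

(** Projection to the first complex coordinate: a continuous left inverse of the curve, which yields
    injectivity, openness onto the image and lifts of curves. *)
Definition base_point (y : 'rV[R]_6) : 'rV[R]_2 :=
  \row_(j < 2) y 0 (widen_ord (isT : 2 <= 6)%N j).

Lemma moment_surfaceK : cancel moment_surface base_point.
Proof.
move=> z; apply/rowP => -[[|[|//]] j2]; rewrite !mxE/=.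
  by congr (z 0 _); exact: val_inj.
by congr (z 0 _); exact: val_inj.
Qed.

Lemma is_diff_coord z j :
  is_diff z (fun x : 'rV[R]_2 => x 0 j : R) (fun u => u 0 j).
Proof.
apply: DiffDef; first exact: differentiable_coord.
apply/funext => u; rewrite -deriveE; last exact: differentiable_coord.
have /matrixP/(_ 0 j) := derive_mx (@derivable_id _ _ z u).
by rewrite derive_id mxE.
Qed.

Lemma is_diff_moment_surface z j :
  is_diff z (fun x => moment_surface x 0 j : R)
            (fun u => dmoment_surface z u 0 j).
Proof.
have dX : is_diff z X X by exact: is_diff_coord.
have dY : is_diff z Y Y by exact: is_diff_coord.
under [X in is_diff _ X]funext do rewrite mxE.
under [X in is_diff _ _ X]funext do rewrite mxE.
case: j => [[|[|[|[|[|[|//]]]]]] j6] //=.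
(* Writing each coordinate as a polynomial in the functions [X] and [Y] lets instance inference
   compute its differential; [ring] then matches it with the stated one. *)
- apply: (@is_diff_eq _ _ _ (X ^+ 2 - Y ^+ 2)).
  apply/funext => u; by rewrite !fctE /GRing.scale/=; ring.
- apply: (@is_diff_eq _ _ _ (2 *: (X * Y))).
  apply/funext => u; by rewrite !fctE /GRing.scale/=; ring.
- apply: (@is_diff_eq _ _ _ (X ^+ 3 - 3 *: (X * Y ^+ 2))).
  apply/funext => u; by rewrite !fctE /GRing.scale/=; ring.
- apply: (@is_diff_eq _ _ _ (3 *: (X ^+ 2 * Y) - Y ^+ 3)).
  apply/funext => u; by rewrite !fctE /GRing.scale/=; ring.
Qed.

Lemma differentiable_moment_surface z : differentiable moment_surface z.
Proof.
by apply: differentiable_row => j; have [] := is_diff_moment_surface z j.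
Qed.

Lemma diff_moment_surface z u : 'd moment_surface z u = dmoment_surface z u.
Proof.
have dM := differentiable_moment_surface z.
rewrite -deriveE// derive_mx; last exact: diff_derivable.
apply/rowP => j; rewrite mxE; have dj := is_diff_moment_surface z j.
by rewrite deriveE// diff_val.
Qed.

Lemma continuous_dmoment_surface u : continuous (dmoment_surface^~ u).
Proof.
have cX : continuous X by exact: coord_continuous.
have cY : continuous Y by exact: coord_continuous.
have cD (f g : 'rV[R]_2 -> R) :
    continuous f -> continuous g -> continuous (fun z => f z + g z).
  by move=> cf cg z; apply: continuousD; [exact: cf|exact: cg].
have cB (f g : 'rV[R]_2 -> R) :
    continuous f -> continuous g -> continuous (fun z => f z - g z).
  by move=> cf cg z; apply: continuousB; [exact: cf|exact: cg].
have cM (f g : 'rV[R]_2 -> R) :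
    continuous f -> continuous g -> continuous (fun z => f z * g z).
  by move=> cf cg z; apply: continuousM; [exact: cf|exact: cg].
have cc (a : R) : continuous (fun _ : 'rV[R]_2 => a) by exact: cst_continuous.
apply: continuous_mx => i j; under [X in continuous X]funext do rewrite mxE.
(* Abstracting the coordinates and the constants [X u], [Y u] leaves polynomials in two continuous
   functions, handled by the closure rules. *)
move: X Y cX cY => f g cf cg; move: (f u) (g u) => a b.
case: j => [[|[|[|[|[|[|//]]]]]] j6] /=;
  repeat first [exact cf | exact cg | exact: cc
              | apply: (cB _ _) | apply: (cD _ _) | apply: (cM _ _)].
Qed.

Lemma C1_moment_surface : C1 moment_surface.
Proof.
split; first exact: differentiable_moment_surface.
apply: continuous_mx => i j.
under [X in continuous X]funext do rewrite mxE diff_moment_surface.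
exact/continuous_entry/continuous_dmoment_surface.
Qed.

Lemma continuous_base_point : continuous base_point.
Proof.
apply: continuous_mx => i j; under [X in continuous X]funext do rewrite mxE.
exact: coord_continuous.
Qed.

Lemma row2P z w : X z = X w -> Y z = Y w -> z = w.
Proof.
move=> EX EY; apply/rowP => -[[|[|//]] j2].
  by rewrite (_ : Ordinal j2 = 0)//; exact: val_inj.
by rewrite (_ : Ordinal j2 = 1)//; exact: val_inj.
Qed.

Lemma dmoment_surface_inj z u v :
  dmoment_surface z u = dmoment_surface z v -> u = v.
Proof.
move=> /rowP E; have := E 0; have := E (inord 1).
by rewrite !mxE !inordK//= => E1 E0; exact: row2P.
Qed.

Lemma C1_embedding_moment_surface : C1_embedding moment_surface.
Proof.
split=> [|z u v||A oA].
- exact: C1_moment_surface.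
- by rewrite !diff_moment_surface; exact: dmoment_surface_inj.
- exact: can_inj moment_surfaceK.
exists (base_point @^-1` A).
  by apply: open_comp => // y _; exact: continuous_base_point.
apply/seteqP; split => [_ [z Az <-]|_ [] /[swap] -[z _ <-]] /=.
  by rewrite moment_surfaceK; split => //; exists z.
by rewrite moment_surfaceK => Az; exists z.
Qed.

(** Near 0 a curve [c] in the image equals [moment_surface \o base_point \o c], so the chain rule
    applies at 0. *)
Lemma tangent_vector_moment_surface z (v : 'rV[R]_6) :
  tangent_vector (range moment_surface) (moment_surface z) v ->
  exists u, v = dmoment_surface z u.
Proof.
move=> [c [[dc _] cM c0 <-]].
pose b t := base_point (c t).
have db : differentiable b 0.
  apply/derivable1_diffP/derivable_mxP => i j.
  under [X in derivable X]funext do rewrite mxE.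
  by move: (dc 0) => /derivable_mxP; apply.
have b0 : b 0 = z by rewrite /b c0 moment_surfaceK.
have dM := differentiable_moment_surface (b 0).
have dMb : differentiable (moment_surface \o b) 0 by exact: differentiable_comp.
exists ('d b 0 1); rewrite -diff_moment_surface derive1E -[in RHS]b0.
have -> : 'D_1 c 0 = 'D_1 (moment_surface \o b) 0.
  apply: near_eq_derive.
  by apply: filterS cM => t [x _ E]; rewrite /= /b -E moment_surfaceK.
by rewrite (deriveE _ dMb) (diff_comp db dM).
Qed.

Lemma dmoment_surfaceZ z k u :
  k *: dmoment_surface z u = dmoment_surface z (k *: u).
Proof.
apply/rowP => -[[|[|[|[|[|[|//]]]]]] j6]; rewrite !mxE /X /Y /= !mxE; ring.
Qed.

(** C has no zero divisors: multiplying (a + ib)(c + id) = 0 by a - ib leaves a^2 + b^2 times each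
    of c and d. *)
Lemma complex_mul_eq0 (a b c d : R) :
  a * c - b * d = 0 -> a * d + b * c = 0 ->
  (a = 0 /\ b = 0) \/ (c = 0 /\ d = 0).
Proof.
move=> Re Im; have [ab0|ab0] := eqVneq (a ^+ 2 + b ^+ 2) 0.
  left; move/eqP: ab0; rewrite paddr_eq0 ?sqr_ge0// !sqrf_eq0.
  by move=> /andP[/eqP-> /eqP->].
right; split; apply: (mulfI ab0); rewrite mulr0.
  have -> : (a ^+ 2 + b ^+ 2) * c =
      a * (a * c - b * d) + b * (a * d + b * c) by ring.
  by rewrite Re Im !mulr0 addr0.
have -> : (a ^+ 2 + b ^+ 2) * d =
    a * (a * d + b * c) - b * (a * c - b * d) by ring.
by rewrite Re Im !mulr0 subr0.
Qed.

(* With d = z - w, the first two complex coordinates give v = u + d and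
   d (d + 2 u) = 0, hence u = - d / 2 unless d = 0; the third one then
   reduces to d ^ 3 = 0. *)
Lemma moment_surface_tangent_planes_disjoint z w u v :
  moment_surface z + dmoment_surface z u =
  moment_surface w + dmoment_surface w v -> z = w.
Proof.
move=> /rowP E.
have := E 0; have := E (inord 1); have := E (inord 2); have := E (inord 3).
have := E (inord 4); have := E (inord 5); rewrite !mxE !inordK//=.
move=> E5 E4 E3 E2 E1 E0.
have [d1 zd1] : exists d1, X z = X w + d1 by exists (X z - X w); ring.
have [d2 zd2] : exists d2, Y z = Y w + d2 by exists (Y z - Y w); ring.
have v1 : X v = X u + d1 by lra.
have v2 : Y v = Y u + d2 by lra.
suff [d10 d20] : d1 = 0 /\ d2 = 0.
  by apply: row2P; rewrite ?zd1 ?zd2 ?d10 ?d20 addr0.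
move: E5 E4 E3 E2; rewrite v1 v2 zd1 zd2 {v1 v2 zd1 zd2 E0 E1 E}.
move: (X w) (Y w) (X u) (Y u) => x y a b E5 E4 E3 E2.
have [//|[a' b']] : (d1 = 0 /\ d2 = 0) \/ (d1 + 2 * a = 0 /\ d2 + 2 * b = 0).
  apply: complex_mul_eq0; lra.
have ad : a = - d1 / 2 by lra.
have bd : b = - d2 / 2 by lra.
rewrite {}ad {}bd {a' b' E3 E2} in E5 E4.
(* Here d^3 = 0 is read as d times d^2, and next d^2 = 0 as d times d. *)
have [//|[dd1 dd2]] : (d1 = 0 /\ d2 = 0) \/
    (d1 * d1 - d2 * d2 = 0 /\ d1 * d2 + d2 * d1 = 0).
  apply: complex_mul_eq0; lra.
by have [|] : (d1 = 0 /\ d2 = 0) \/ (d1 = 0 /\ d2 = 0)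
  by apply: complex_mul_eq0.
Qed.

(** The first two complex coordinates give u = v and 2zu = 2wv, hence (z - w)u = 0. *)
Lemma dmoment_surface_eq z w u v : z != w ->
  dmoment_surface z u = dmoment_surface w v -> u = 0.
Proof.
move=> zw /rowP E.
have := E 0; have := E (inord 1); have := E (inord 2); have := E (inord 3).
rewrite !mxE !inordK//= => E3 E2 E1 E0.
have [[d1 d2]|[u1 u2]] :
    (X z - X w = 0 /\ Y z - Y w = 0) \/ (X u = 0 /\ Y u = 0).
- apply: complex_mul_eq0; rewrite -E0 -E1 in E2 E3; lra.
- by case/eqP: zw; apply: row2P; lra.
- by apply: row2P; rewrite ?u1 ?u2 /X /Y mxE.
Qed.

Lemma totally_skew_moment_surface : totally_skew_embedding moment_surface.
Proof.
split; first exact: C1_embedding_moment_surface.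
split.
  (* The curve itself is a single global parametrization. *)
  move=> p Mp; exists setT; split => //; first exact: openT.
  by exists moment_surface; [exact: C1_embedding_moment_surface|rewrite setIT].
move=> _ _ L1 L2 [z _ <-] [w _ <-] Mzw.
have zw : z != w by apply/eqP => zw; apply: Mzw; rewrite zw.
move=> [_ [/tangent_vector_moment_surface[u ->] u0 ->]].
move=> [_ [/tangent_vector_moment_surface[v ->] v0 ->]].
split.
  move=> /parallel_line[k]; rewrite dmoment_surfaceZ => E.
  (* With the two points exchanged, [E] forces [v = 0], so the second line would have a zero
     direction. *)
  have wz : w != z by rewrite eq_sym.
  case/eqP: v0; rewrite (dmoment_surface_eq wz E).
  by rewrite -[X in dmoment_surface w X](scale0r 0) -dmoment_surfaceZ scale0r.
rewrite -subset0 => x [[t _ <-] [s _]].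
rewrite !dmoment_surfaceZ => /esym/moment_surface_tangent_planes_disjoint.
by move/eqP: zw.
Qed.

End ComplexMomentCurve.

Theorem corollary5p2 (R : realType) : is_least_skew_dim R 2 6.
Proof.
split; first by exists (@moment_surface R); exact: totally_skew_moment_surface.
move=> N [f skf]; have := totally_skew_dim_gt (ltn0Sn 1) skf.
(* The bound reads 5 <= N, so N is either 5, already excluded, or at least 6. *)
rewrite leq_eqVlt => /predU1P[N5|//].
by case: (@no_totally_skew_5 R); move: f skf; rewrite -N5 => f skf; exists f.
Qed.
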